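(* Let $G$ be a Coxeter group, viewed as a poset under the Bruhat order. For $v \le w$ in $G$, the interval $[v,w]=\{u\in G : v\le u\le w\}$ is boolean if and only if it is a modular lattice.
   Context: A Coxeter group $G$ comes with its generating set $S$ of involutions and relations $(st)^{m(s,t)}=1$. A reduced decomposition of $w\in G$ is an expression $w=s_1\cdots s_\ell$ with $s_i\in S$ and $\ell$ minimal. Bruhat order: $v\le w$ if some reduced decomposition of $v$ is a (not necessarily contiguous) subword of a reduced decomposition of $w$. A poset is boolean if it is isomorphic to the poset of all subsets of a finite set, ordered by inclusion. *)

(* Defs.v *)
From Corelib Require Relation_Definitions.
From mathcomp Require Import all_boot.

Set Implicit Arguments.
Unset Strict Implicit.
Unset Printing Implicit Defensive.

Local Open Scope group_scope.

(** ** Coxeter groups *)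

(* The value 0 encodes m(s,t) = infinity; the relation (st)^0 = 1 is vacuous. *)
Definition coxeter_matrix (S : eqType) (m : S -> S -> nat) : Prop :=
  (forall s t, m s t = m t s) /\ (forall s t, (m s t == 1%N) = (s == t)).

(* Words over S and its formal inverses: (s, true) is the letter s and
   (s, false) is the letter s^-1. *)
Definition gword (S : Type) : Type := seq (S * bool).

Definition coxeter_relator (S : Type) (m : S -> S -> nat) (s t : S) : gword S :=
  flatten (nseq (m s t) [:: (s, true); (t, true)]).

(* Equality in the group presented by the generators S and the relations
   (st)^{m(s,t)} = 1, i.e. in the free group on S modulo the normal closure of
   the relators. *)
Inductive presented_eq (S : Type) (m : S -> S -> nat) :
    gword S -> gword S -> Prop :=
| presented_refl a : presented_eq m a a
| presented_sym a b : presented_eq m a b -> presented_eq m b a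
| presented_trans a b c :
    presented_eq m a b -> presented_eq m b c -> presented_eq m a c
| presented_cancel a b s e :
    presented_eq m (a ++ [:: (s, e); (s, ~~ e)] ++ b) (a ++ b)
| presented_relator a b s t :
    presented_eq m (a ++ coxeter_relator m s t ++ b) (a ++ b).

Definition eval_gword (S : Type) (G : groupType) (gen : S -> G)
    (a : gword S) : G :=
  \prod_(x <- a) (if x.2 then gen x.1 else (gen x.1)^-1).

(* The generating subset of G is given as the injective family gen. *)
Record coxeter_system (G : groupType) (S : eqType) (m : S -> S -> nat)
    (gen : S -> G) : Prop := CoxeterSystem {
  coxeter_system_matrix : coxeter_matrix m;
  coxeter_system_inj : injective gen;
  coxeter_system_generated : forall g, exists a, eval_gword gen a = g;
  coxeter_system_presented : forall a b,
    eval_gword gen a = eval_gword gen b <-> presented_eq m a b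
}.

(** ** Bruhat order *)

Definition word_prod (S : Type) (G : groupType) (gen : S -> G) (a : seq S) : G :=
  \prod_(s <- a) gen s.

Definition reduced_decomposition (S : Type) (G : groupType) (gen : S -> G)
    (w : G) (a : seq S) : Prop :=
  word_prod gen a = w /\ (forall b, word_prod gen b = w -> size a <= size b).

Definition bruhat (S : eqType) (G : groupType) (gen : S -> G) (v w : G) : Prop :=
  exists a b : seq S,
    [/\ reduced_decomposition gen v a, reduced_decomposition gen w b
      & subseq a b].

Definition bruhat_interval (S : eqType) (G : groupType) (gen : S -> G)
    (v w : G) : Type :=
  {u : G | bruhat gen v u /\ bruhat gen u w}.

Definition interval_le (S : eqType) (G : groupType) (gen : S -> G) (v w : G)
    (x y : bruhat_interval gen v w) : Prop :=
  bruhat gen (sval x) (sval y).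

(** ** Boolean posets and modular lattices *)

Definition boolean_poset (T : Type) (le : T -> T -> Prop) : Prop :=
  exists (A : finType) (f : T -> {set A}),
    bijective f /\ (forall x y, le x y <-> f x \subset f y).

Definition is_meet (T : Type) (le : T -> T -> Prop) (x y z : T) : Prop :=
  [/\ le z x, le z y & forall t, le t x -> le t y -> le t z].

Definition is_join (T : Type) (le : T -> T -> Prop) (x y z : T) : Prop :=
  [/\ le x z, le y z & forall t, le x t -> le y t -> le z t].

Definition modular_lattice (T : Type) (le : T -> T -> Prop) : Prop :=
  Relation_Definitions.order T le /\
  exists meet join : T -> T -> T,
    [/\ forall x y, is_meet le x y (meet x y),
        forall x y, is_join le x y (join x y)
      & forall x y z, le x z -> join x (meet y z) = meet (join x y) z].

(* Main.v *)
(* A modular lattice of finite length is semimodular, so joining an atom raises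
   the rank by at most one. Intervals of length two in the Bruhat order have
   exactly two middle elements. In a finite graded modular lattice with that
   property, two middle elements at least give that every element is the join of
   the atoms below it, and two at most give that an atom below the join of a set
   of atoms belongs to that set, so sending an element to its set of atoms is an
   isomorphism onto a powerset.

   The Bruhat order is handled as the order generated by right multiplication by
   reflections that raise the length. Everything about it follows from the
   strong exchange property; that property holds because the parity with which a
   reflection occurs among the reflections attached to a word is unchanged by
   the defining relations, hence depends only on the product of the word. The
   statement on intervals of length two is obtained by induction on the length
   of the top element, with the lifting property for a right descent of it. *)

Require Import Defs.
From mathcomp Require Import all_boot zify boolp.

Set Implicit Arguments.
Unset Strict Implicit.
Unset Printing Implicit Defensive.

Local Open Scope group_scope.

(** * Words in the generators, their products and the parity of their reflections *)

Section CoxeterLength.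

Variables (G : groupType) (S : eqType) (m : S -> S -> nat) (gen : S -> G).
Hypothesis cox : coxeter_system m gen.

Local Notation prod := (word_prod gen).

Lemma word_prod_nil : prod [::] = 1.
Proof. by rewrite /word_prod big_nil. Qed.

Lemma word_prod_cons s a : prod (s :: a) = gen s * prod a.
Proof. by rewrite /word_prod big_cons. Qed.

Lemma word_prod_cat a b : prod (a ++ b) = prod a * prod b.
Proof. by rewrite /word_prod big_cat. Qed.

Lemma word_prod_rcons a s : prod (rcons a s) = prod a * gen s.
Proof. by rewrite -cats1 word_prod_cat word_prod_cons word_prod_nil mulg1. Qed.

Lemma eval_relator s t : eval_gword gen (coxeter_relator m s t) = 1.
Proof.
have := presented_relator m [::] [::] s t.
move/(coxeter_system_presented cox); rewrite !cats0 => ->.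
by rewrite /eval_gword big_nil.
Qed.

Lemma eval_positive a : eval_gword gen [seq (s, true) | s <- a] = prod a.
Proof. by rewrite /eval_gword big_map. Qed.

Lemma relator_positive s t : coxeter_relator m s t =
  [seq (x, true) | x <- flatten (nseq (m s t) [:: s; t])].
Proof. by rewrite /coxeter_relator; elim: (m s t) => //= n ->. Qed.

Lemma genK s : gen s * gen s = 1.
Proof.
have := eval_relator s s; rewrite relator_positive eval_positive.
have [_ /(_ s s)] := coxeter_system_matrix cox; rewrite eqxx => /eqP -> /=.
by rewrite !word_prod_cons word_prod_nil mulg1.
Qed.

Lemma genV s : (gen s)^-1 = gen s.
Proof. by apply/eqP; rewrite eq_sym -mulg_eq1 genK. Qed.

Lemma mul_genK s : involutive ( *%g^~ (gen s)).
Proof. by move=> x /=; rewrite -mulgA genK mulg1. Qed.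

Lemma conjg_gen s : gen s ^ gen s = gen s.
Proof. by rewrite conjgE mulKg. Qed.

Lemma word_prod_rev a : prod (rev a) = (prod a)^-1.
Proof.
elim: a => [|s a IHa]; first by rewrite word_prod_nil invg1.
by rewrite rev_cons word_prod_rcons IHa word_prod_cons invgM genV.
Qed.

Lemma eval_forget_signs a : eval_gword gen a = prod (map fst a).
Proof.
rewrite /word_prod big_map; apply: eq_bigr => -[s []] //= _; exact: genV.
Qed.

Lemma word_prod_surj g : exists a, prod a = g.
Proof.
have [a <-] := coxeter_system_generated cox g.
by exists (map fst a); rewrite eval_forget_signs.
Qed.

(* Right multiplication of a word by the [i]-th of these reflections deletes
   its [i]-th letter. *)
Fixpoint word_reflections (a : seq S) : seq G :=
  if a is s :: a' then gen s ^ prod a' :: word_reflections a' else [::].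

(** The parity of the count, unlike the count itself, depends only on the product of the word
    ([inversion_prod]). *)
Definition inversion (a : seq S) (t : G) : bool :=
  odd (count_mem t (word_reflections a)).

Lemma word_reflections_cat a b : word_reflections (a ++ b) =
  [seq t ^ prod b | t <- word_reflections a] ++ word_reflections b.
Proof. by elim: a => //= s a ->; rewrite word_prod_cat conjgM. Qed.

Lemma inversion_cat a b t :
  inversion (a ++ b) t = inversion a (t ^ (prod b)^-1) (+) inversion b t.
Proof.
rewrite /inversion word_reflections_cat count_cat oddD count_map.
congr (odd _ (+) _); apply: eq_count => x /=.
by rewrite (can2_eq (conjgK _) (conjgKV _)).
Qed.

Lemma inversion_insert a b c t :
    prod c = 1 -> (forall u, inversion c u = false) ->
  inversion (a ++ c ++ b) t = inversion (a ++ b) t.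
Proof.
move=> c1 invc; rewrite !inversion_cat invc /=.
by rewrite word_prod_cat c1 mul1g.
Qed.

(** Listing the reflections by consecutive exponents [j] makes them visibly periodic once a power of
    [gen s * gen t] is trivial. *)
Lemma word_reflections_dihedral s t n :
  word_reflections (flatten (nseq n [:: s; t])) =
  rev [seq gen t * (gen s * gen t) ^+ j | j <- iota 0 n.*2].
Proof.
have prodE k : prod (flatten (nseq k [:: s; t])) = (gen s * gen t) ^+ k.
  elim: k => [|k IHk] /=; first by rewrite word_prod_nil.
  by rewrite !word_prod_cons IHk expgS mulgA.
have conjt k : gen t ^ ((gen s * gen t) ^+ k) =
    gen t * (gen s * gen t) ^+ k.*2.
  elim: k => [|k IHk]; first by rewrite conjg1 mulg1.
  by rewrite expgSr conjgM IHk conjgE invgM !genV doubleS expgS expgSr !mulgA.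
elim: n => [//|n IHn]; rewrite doubleS -addn2 iotaD map_cat rev_cat -IHn.
rewrite /= word_prod_cons prodE.
rewrite conjt conjgM.
have -> : gen s ^ gen t = gen t * (gen s * gen t) by rewrite conjgE genV.
rewrite conjMg conjt; congr (_ :: _).
have /conjg_fixP -> : [~ gen s * gen t, (gen s * gen t) ^+ n] == 1.
  by rewrite commgXg.
by rewrite -mulgA -expgSr.
Qed.

(** The exponents run over two periods of length [m s t], so the two halves of the list agree and
    every count is even. *)
Lemma inversion_relator s t u :
  inversion (flatten (nseq (m s t) [:: s; t])) u = false.
Proof.
have st1 : (gen s * gen t) ^+ m s t = 1.
  rewrite -(eval_relator s t) relator_positive eval_positive.
  elim: (m s t) => [|n IHn] /=; first by rewrite word_prod_nil.
  by rewrite !word_prod_cons -IHn expgS mulgA.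
rewrite /inversion word_reflections_dihedral count_rev -addnn iotaD map_cat.
rewrite count_cat add0n oddD -{2}(addn0 (m s t)) iotaDl -map_comp.
rewrite (@eq_map _ _ _ (fun j => gen t * (gen s * gen t) ^+ j)) ?addbb//.
by move=> j /=; rewrite expgnDr st1 mul1g.
Qed.

Lemma inversion_presented_eq a b t : presented_eq m a b ->
  inversion (map fst a) t = inversion (map fst b) t.
Proof.
move=> ab; elim: ab t => {a b}//.
- by move=> a b c _ IHab _ IHbc t; rewrite IHab.
- move=> a b s e t; rewrite !map_cat; apply: inversion_insert => [|u] /=.
    by rewrite !word_prod_cons word_prod_nil mulg1 genK.
  rewrite /inversion /= word_prod_cons word_prod_nil !mulg1 conjg1 conjg_gen.
  by case: eqP.
- move=> a b s t u; rewrite !map_cat; apply: inversion_insert => [|x].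
    by rewrite -eval_forget_signs eval_relator.
  rewrite relator_positive -map_comp map_id; exact: inversion_relator.
Qed.

Lemma inversion_prod a b t : prod a = prod b -> inversion a t = inversion b t.
Proof.
rewrite -!eval_positive => /(coxeter_system_presented cox).
by move/(inversion_presented_eq t); rewrite -!map_comp !map_id.
Qed.

(** * Length, reflections and strong exchange *)

Lemma length_exists g : exists n, `[< exists2 a, prod a = g & size a = n >].
Proof.
have [a <-] := word_prod_surj g.
by exists (size a); apply/asboolP; exists a.
Qed.

Definition length (g : G) : nat := ex_minn (length_exists g).

Lemma length_le a : length (prod a) <= size a.
Proof.
rewrite /length; case: ex_minnP => n _; apply; apply/asboolP.
by exists a.
Qed.

Lemma length_word g : exists2 a, prod a = g & size a = length g.
Proof. by rewrite /length; case: ex_minnP => n /asboolP. Qed.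

Definition reduced (a : seq S) : Prop := size a = length (prod a).

Lemma reduced_decompositionP w a :
  reduced_decomposition gen w a <-> prod a = w /\ reduced a.
Proof.
split=> -[<- ha]; split=> //.
  apply/eqP; rewrite eqn_leq length_le andbT.
  by have [b eb <-] := length_word (prod a); apply: ha.
by move=> b eb; rewrite ha -eb length_le.
Qed.

Lemma length_mul_gen g s : length (g * gen s) <= (length g).+1.
Proof.
have [a <- <-] := length_word g.
by rewrite -word_prod_rcons -(size_rcons a s) length_le.
Qed.

Definition reflection (t : G) : Prop := exists g s, t = gen s ^ g.

Lemma reflection_gen s : reflection (gen s).
Proof. by exists 1, s; rewrite conjg1. Qed.

Lemma reflection_conj t g : reflection t -> reflection (t ^ g).
Proof. by move=> [h [s ->]]; exists (h * g), s; rewrite conjgM. Qed.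

Lemma reflectionK t : reflection t -> t * t = 1.
Proof. by move=> [g [s ->]]; rewrite -conjMg genK conj1g. Qed.

(** Write [t] as the product of a palindrome [rev c ++ s :: c] and append it to [a]. The
    contribution of [a] at [t] is unchanged, since [t] commutes with itself, and the palindrome
    contributes an odd number. *)
Lemma inversion_mul_reflection a b t : reflection t -> prod b = prod a * t ->
  inversion b t = ~~ inversion a t.
Proof.
move=> rt; have [g [s ts]] := rt; have [c ec] := word_prod_surj g.
have ed : prod (rev c ++ s :: c) = t.
  by rewrite word_prod_cat word_prod_rev word_prod_cons ts ec conjgE.
have tV : t ^ t^-1 = t by rewrite conjgE invgK mulgV mulg1.
rewrite -{1}ed -word_prod_cat => /inversion_prod ->.
rewrite inversion_cat ed tV -[RHS]addbT; congr (_ (+) _).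
have ts' : t ^ (prod c)^-1 = gen s by rewrite ts ec conjgK.
(* Since [rev c ++ c] has trivial product, the outer parts of the palindrome cancel and only its
   middle letter counts. *)
have e1 : inversion (rev c) (gen s) = inversion c t.
  have := @inversion_prod (rev c ++ c) [::] t.
  rewrite word_prod_cat word_prod_rev mulVg word_prod_nil => /(_ erefl).
  by rewrite inversion_cat ts' {3}/inversion; do 2 case: inversion.
rewrite inversion_cat word_prod_cons invgM conjgM ts' genV conjg_gen e1.
by rewrite /inversion /= oddD ec -ts eqxx addbCA addbb.
Qed.

Lemma inversion_delete a t : inversion a t ->
  exists b, [/\ subseq b a, (size b).+1 = size a & prod b = prod a * t].
Proof.
have: inversion a t -> t \in word_reflections a.
  by rewrite -has_pred1 has_count /inversion; case: count.
move=> h /h {h}; elim: a => // s a IHa.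
rewrite [_ \in _]inE => /predU1P[->|/IHa].
  exists a; split; rewrite ?subseq_cons//.
  by rewrite word_prod_cons conjgE !mulgA mulgK genK mul1g.
move=> [b [sb szb eb]]; exists (s :: b).
by rewrite /= eqxx szb !word_prod_cons eb mulgA.
Qed.

(** An inversion of [a] is also one of a shortest word for [prod a], where it deletes a letter. If
    [t] is not an inversion of [a], it is one of any word for [prod a * t], and the same argument
    applies there. *)
Lemma length_mul_reflection a t : reflection t ->
  if inversion a t then length (prod a * t) < length (prod a)
  else length (prod a) < length (prod a * t).
Proof.
have shorten b u : inversion b u -> length (prod b * u) < length (prod b).
  have [c ec <-] := length_word (prod b).
  rewrite -(inversion_prod u ec) => /inversion_delete[d [_ <- ed]].
  by rewrite -ec -ed ltnS length_le.
move=> rt; case: ifP => [/shorten//|invN].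
have [b eb] := word_prod_surj (prod a * t).
have /shorten : inversion b t by rewrite (inversion_mul_reflection rt eb) invN.
by rewrite eb -mulgA (reflectionK rt) mulg1.
Qed.

Lemma strong_exchange a t : reflection t ->
    length (prod a * t) < length (prod a) ->
  exists b, [/\ subseq b a, (size b).+1 = size a & prod b = prod a * t].
Proof.
move=> /(length_mul_reflection a); case: ifP => [/inversion_delete//|_].
by move=> h h'; have := ltn_trans h h'; rewrite ltnn.
Qed.

Lemma length_mul_gen_neq g s :
  (length (g * gen s) < length g) || (length g < length (g * gen s)).
Proof.
have [a <-] := word_prod_surj g.
have := length_mul_reflection a (reflection_gen s).
by case: ifP => _ ->; rewrite ?orbT.
Qed.

Lemma length_mul_genE g s :
  length (g * gen s) = if length (g * gen s) < length g
                       then (length g).-1 else (length g).+1.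
Proof.
have := length_mul_gen g s; have := length_mul_gen (g * gen s) s.
rewrite mul_genK; have := length_mul_gen_neq g s.
by case: ifP; lia.
Qed.

(** Letters are appended one at a time; one that lowers the length is absorbed by deleting an
    earlier letter. *)
Lemma reduced_subword a :
  exists b, [/\ subseq b a, reduced b & prod b = prod a].
Proof.
elim/last_ind: a => [|a s [b [sb rb eb]]].
  exists [::]; split=> //; rewrite /reduced /=.
  by apply/eqP; rewrite eq_sym -leqn0 length_le.
rewrite word_prod_rcons -eb.
have := length_mul_genE (prod b) s; case: ifP => [lt _|_ e].
  have [c [sc szc ec]] := strong_exchange (reflection_gen s) lt.
  exists c; split=> //.
    by apply: subseq_trans sc (subseq_trans sb _); rewrite subseq_rcons.
  have := length_mul_genE (prod b) s; rewrite lt.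
  by rewrite /reduced ec -rb -szc.
exists (rcons b s); split.
- by rewrite -!cats1 cat_subseq.
- by rewrite /reduced size_rcons word_prod_rcons e rb.
by rewrite word_prod_rcons.
Qed.

Lemma reduced_rcons g s : length (g * gen s) < length g ->
  exists a, [/\ reduced a, reduced (rcons a s), prod a = g * gen s
              & prod (rcons a s) = g].
Proof.
move=> lt; have [a ea sa] := length_word (g * gen s).
have eas : prod (rcons a s) = g by rewrite word_prod_rcons ea mul_genK.
exists a; split=> //; first by rewrite /reduced sa ea.
have := length_mul_genE g s; rewrite lt => e.
by rewrite /reduced eas size_rcons sa e prednK// (leq_ltn_trans _ lt).
Qed.


(** * The order generated by reflections and the subword property *)

Inductive chain_le (x : G) : G -> Prop :=
| chain_le_refl : chain_le x x
| chain_le_step y t : chain_le x y -> reflection t ->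
    length y < length (y * t) -> chain_le x (y * t).

Lemma chain_le_trans y x z : chain_le x y -> chain_le y z -> chain_le x z.
Proof. by move=> xy; elim=> // w t _; apply: chain_le_step. Qed.

Lemma chain_le_gen x s :
  length x < length (x * gen s) -> chain_le x (x * gen s).
Proof. by apply: chain_le_step (chain_le_refl x) (reflection_gen s). Qed.

Lemma chain_le_gen_down x s :
  length (x * gen s) < length x -> chain_le (x * gen s) x.
Proof.
by move=> lt; rewrite -{2}(mul_genK s x); apply: chain_le_gen; rewrite mul_genK.
Qed.

Lemma chain_le_length x y : chain_le x y -> x = y \/ length x < length y.
Proof.
elim=> [|z t _ [->|lt] _ ltt]; [by left|by right|right].
exact: ltn_trans lt ltt.
Qed.

Lemma chain_le_lt x y : chain_le x y -> x <> y -> length x < length y.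
Proof. by case/chain_le_length. Qed.

Lemma chain_le_eq x y : chain_le x y -> length y <= length x -> x = y.
Proof. by case/chain_le_length=> // lt; rewrite leqNgt lt. Qed.

(** Each step down the chain deletes a letter by strong exchange, which applies to words that are
    not reduced; only the final word is made reduced. *)
Lemma chain_le_subword x y b : chain_le x y -> prod b = y ->
  exists a, [/\ subseq a b, reduced a & prod a = x].
Proof.
move=> xy eb; suff [a sab <-] : exists2 a, subseq a b & prod a = x.
  have [c [sca rc ec]] := reduced_subword a.
  by exists c; rewrite (subseq_trans sca).
elim: xy b eb => [|z t _ IH rt lt] b eb; first by exists b.
have [|c [scb _ ec]] := @strong_exchange b t rt.
  by rewrite eb -mulgA (reflectionK rt) mulg1.
have [|a sac ea] := IH c; first by rewrite ec eb -mulgA (reflectionK rt) mulg1.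
by exists a => //; apply: subseq_trans sac scb.
Qed.

(* The reflections of [rcons a s] are those of [a] conjugated by [gen s], together
   with [gen s], so for [t <> gen s] multiplying by [t] moves the length of [y] in
   the same direction as multiplying by [t ^ gen s] moves that of [y * gen s]. *)
Lemma chain_le_mul_step y t s : reflection t -> length y < length (y * t) ->
  t = gen s \/ chain_le (y * gen s) (y * t * gen s).
Proof.
move=> rt lt; have [->|/eqP nts] := eqVneq t (gen s); [by left|right].
have e : y * t * gen s = y * gen s * t ^ gen s.
  by rewrite conjgE genV !mulgA mul_genK.
have rts := reflection_conj (gen s) rt.
have [a ea] := word_prod_surj (y * gen s).
have eas : prod (a ++ [:: s]) = y.
  by rewrite cats1 word_prod_rcons ea mul_genK.
have := length_mul_reflection (a ++ [:: s]) rt.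
rewrite eas inversion_cat {2}/inversion /= word_prod_cons word_prod_nil conjg1.
rewrite mulg1 genV (introF eqP (nesym nts)) addbF.
have := length_mul_reflection a rts; rewrite e ea.
case: ifP => _ lta lty; last exact: chain_le_step (chain_le_refl _) rts lta.
by have := ltn_trans lt lty; rewrite ltnn.
Qed.

(** A lifting property without conditions on descents. Knowing whether [s] is an ascent or a descent
    of [y] lets one alternative imply the other, as in the next two lemmas. *)
Lemma chain_le_mul x y s : chain_le x y ->
  chain_le (x * gen s) y \/ chain_le (x * gen s) (y * gen s).
Proof.
elim=> [|z t _ IH rt lt]; first by right; apply: chain_le_refl.
have lezt : chain_le z (z * t) by apply: chain_le_step (chain_le_refl z) rt lt.
case: IH => [xz|xzs]; first by left; apply: chain_le_trans xz lezt.
have [ts|zts] := chain_le_mul_step s rt lt; first by left; rewrite ts.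
by right; apply: chain_le_trans xzs zts.
Qed.

Lemma chain_le_mul_up x y s : chain_le x y -> length y < length (y * gen s) ->
  chain_le (x * gen s) (y * gen s).
Proof.
move=> xy lt; case: (chain_le_mul s xy) => // xsy.
exact: chain_le_trans xsy (chain_le_gen lt).
Qed.

Lemma chain_le_mul_down x y s : chain_le x y -> length (y * gen s) < length y ->
  chain_le (x * gen s) y.
Proof.
move=> xy lt; case: (chain_le_mul s xy) => // xys.
exact: chain_le_trans xys (chain_le_gen_down lt).
Qed.

(** Induction on the last letter of [b]: either the subword uses it, and [chain_le_mul_up] applies,
    or it is already a subword of the rest. *)
Lemma subword_chain_le a b :
  reduced b -> subseq a b -> chain_le (prod a) (prod b).
Proof.
elim/last_ind: b a => [|b s IHb] a rb.
  by rewrite subseq0 => /eqP ->; apply: chain_le_refl.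
have rb' : reduced b.
  have := length_mul_gen (prod b) s; have := length_le b.
  by move: rb; rewrite /reduced size_rcons word_prod_rcons; lia.
have up : length (prod b) < length (prod b * gen s).
  by rewrite -word_prod_rcons -rb -rb' size_rcons.
(* [subseq] compares heads, so both words are reversed to compare last letters. *)
rewrite word_prod_rcons -subseq_rev rev_rcons.
case/lastP: a => [|a s'].
  move=> _; have := IHb [::] rb' (sub0seq b) => h.
  exact: chain_le_trans h (chain_le_gen up).
rewrite rev_rcons /=; case: eqP => [->|_].
  rewrite subseq_rev => sab; rewrite word_prod_rcons.
  exact: chain_le_mul_up (IHb _ rb' sab) up.
rewrite -rev_rcons subseq_rev => sab.
exact: chain_le_trans (IHb _ rb' sab) (chain_le_gen up).
Qed.

Lemma bruhatP v w : bruhat gen v w <-> chain_le v w.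
Proof.
split=> [[a [b [/reduced_decompositionP[<- _]]]]|vw].
  by move=> /reduced_decompositionP[<- rb]; apply: subword_chain_le.
have [b eb sb] := length_word w.
have [a [sab ra ea]] := chain_le_subword vw eb.
exists a, b; split=> //; apply/reduced_decompositionP; split=> //.
by rewrite /reduced eb.
Qed.

(** * Lifting, gradedness and intervals of length two *)

Lemma chain_le_lift x y s : chain_le x y -> length (y * gen s) < length y ->
    length x < length (x * gen s) ->
  chain_le x (y * gen s).
Proof.
move=> xy lty ltx; have [b [rb _ eb ebs]] := reduced_rcons lty.
have [a [sab ra ea]] := chain_le_subword xy ebs.
rewrite -eb -ea; apply: subword_chain_le => //.
(* A reduced word for [x] cannot end in [s], which is an ascent of [x]; so the subword avoids the
   last letter of [rcons b s]. *)
case/lastP: a sab ra ea => [|a s'] sab ra ea; first exact: sub0seq.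
move: sab; rewrite -subseq_rev !rev_rcons /=; case: eqP => [es|_]; last first.
  by rewrite -rev_rcons subseq_rev.
move: ltx; rewrite -ea es word_prod_rcons mul_genK.
have := length_le a; move: ra.
by rewrite /reduced size_rcons es word_prod_rcons; lia.
Qed.

Lemma chain_le_descent x y s : chain_le x y ->
    length (y * gen s) < length y -> length (x * gen s) < length x ->
  chain_le (x * gen s) (y * gen s).
Proof.
move=> xy lty ltx; apply: chain_le_lift lty _; last by rewrite mul_genK.
exact: chain_le_trans (chain_le_gen_down ltx) xy.
Qed.

Lemma exists_descent y : 0 < length y ->
  exists s, length (y * gen s) < length y.
Proof.
have [a <- <-] := length_word y; case/lastP: a => // a s _; exists s.
rewrite word_prod_rcons mul_genK size_rcons ltnS; exact: length_le.
Qed.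

(** A step of a chain may raise the length by more than one, so gradedness needs proof. An element
    between [x * gen s] and [y * gen s], for a descent [s] of [y], is carried back up. *)
Lemma chain_le_between x y : chain_le x y -> (length x).+1 < length y ->
  exists z, [/\ chain_le x z, chain_le z y & length x < length z < length y].
Proof.
have [n] := ubnP (length y); elim: n x y => // n IHn x y lyn xy lxy.
have [|s lty] := @exists_descent y; first by lia.
have ey := length_mul_genE y s; rewrite lty in ey.
have ysy := chain_le_gen_down lty.
have ex := length_mul_genE x s.
have [ltx|ltx] := orP (length_mul_gen_neq x s); last first.
  exists (x * gen s); split; [exact: chain_le_gen|exact: chain_le_mul_down|].
  by move: ex; case: ifP; lia.
rewrite ltx in ex; have xys := chain_le_descent xy lty ltx.
have [||z [xz zy lz]] := IHn (x * gen s) (y * gen s) _ xys; try by lia.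
have ez := length_mul_genE z s.
have [ltz|ltz] := orP (length_mul_gen_neq z s); last first.
  exists (z * gen s); split.
  - by rewrite -[x](mul_genK s); apply: chain_le_mul_up.
  - rewrite -[y](mul_genK s); apply: chain_le_mul_up => //.
    by rewrite mul_genK.
  - by move: ez; case: ifP; lia.
have xz' : chain_le x z by rewrite -[x](mul_genK s); apply: chain_le_mul_down.
have zy' := chain_le_trans zy ysy.
have [ltxz|lezx] := ltnP (length x) (length z).
  by exists z; split=> //; lia.
(* Here [z] is [x] itself, so [x] lies below [y * gen s]. *)
exists (y * gen s); split=> //; last by lia.
by rewrite (chain_le_eq xz' lezx).
Qed.

Definition rank_one_between (x y z : G) : Prop :=
  [/\ chain_le x z, chain_le z y & length z = (length x).+1].

(** If [s] is a descent of [z], multiplication by [gen s] moves [z] to the lower interval; otherwise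
    lifting puts [z] below [y * gen s], and lengths make them equal. The value [x] is excluded below
    because it would come back as [x * gen s], which is too short. *)
Lemma rank_one_between_descent x y s z : chain_le x y ->
    length y = (length x).+2 ->
    length (y * gen s) < length y -> length (x * gen s) < length x ->
  rank_one_between x y z <->
  (z = y * gen s /\ chain_le x (y * gen s)) \/
  (rank_one_between (x * gen s) (y * gen s) (z * gen s) /\ z * gen s <> x).
Proof.
move=> xy lxy lty ltx.
have ey := length_mul_genE y s; rewrite lty in ey.
have ex := length_mul_genE x s; rewrite ltx in ex.
have ez := length_mul_genE z s.
split=> [[xz zy lz]|[[-> xys]|[[xz zy lz] zsx]]].
- have [ltz|ltz] := orP (length_mul_gen_neq z s); last first.
    have zys := chain_le_lift zy lty ltz.
    by left; rewrite -(chain_le_eq zys) //; lia.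
  right; split; last by move=> zsx; move: lz ex; rewrite -zsx mul_genK; lia.
  rewrite ltz in ez.
  by split; [exact: chain_le_descent|exact: chain_le_descent|lia].
- by split=> //; [exact: chain_le_gen_down|lia].
have ltz : length (z * gen s) < length z.
  have [//|lt] := orP (length_mul_gen_neq z s).
  have xzs : chain_le x (z * gen s).
    rewrite -[x](mul_genK s); apply: chain_le_mul_down xz _.
    by rewrite mul_genK.
  by case: zsx; apply/esym/(chain_le_eq xzs); lia.
split.
- rewrite -[x](mul_genK s) -[z](mul_genK s).
  by apply: chain_le_mul_up xz _; rewrite mul_genK.
- rewrite -[y](mul_genK s) -[z](mul_genK s).
  by apply: chain_le_mul_up zy _; rewrite mul_genK.
by rewrite ltz in ez; lia.
Qed.

(** Let [s] be a descent of [y]. If it is an ascent of [x], the middle elements are [x * gen s] and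
    [y * gen s]. Otherwise they come from the lower interval; if [x] is a middle element there, its
    image is lost and [y * gen s] takes its place. *)
Lemma chain_le_diamond x y : chain_le x y -> length y = (length x).+2 ->
  exists z1 z2, z1 <> z2 /\
    forall z, rank_one_between x y z <-> z = z1 \/ z = z2.
Proof.
have [n] := ubnP (length y); elim: n x y => // n IHn x y lyn xy lxy.
have [|s lty] := @exists_descent y; first by lia.
have ey := length_mul_genE y s; rewrite lty in ey.
have ex := length_mul_genE x s.
have [ltx|ltx] := orP (length_mul_gen_neq x s); last first.
  exists (x * gen s), (y * gen s); split.
    by move/(can_inj (mul_genK s)) => e; move: lxy; rewrite e; lia.
  have xys := chain_le_lift xy lty ltx.
  have xsy := chain_le_mul_down xy lty.
  move: ex; rewrite ltnNge (ltnW ltx) /= => ex.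
  move=> z; split=> [[xz zy lz]|[]->]; last 2 first.
  - by split=> //; apply: chain_le_gen.
  - by split=> //; [apply: chain_le_gen_down|lia].
  have [ltz|ltz] := orP (length_mul_gen_neq z s); last first.
    by right; apply: chain_le_eq; [apply: chain_le_lift zy lty ltz|lia].
  left; have xzs := chain_le_lift xz ltz ltx.
  have ez := length_mul_genE z s; rewrite ltz in ez.
  by rewrite (chain_le_eq xzs) ?mul_genK //; lia.
rewrite ltx in ex; have xys := chain_le_descent xy lty ltx.
have [||z1 [z2 [nz hz]]] := IHn (x * gen s) (y * gen s) _ xys; try by lia.
have hz' z := rank_one_between_descent z xy lxy lty ltx.
have mulK z u : z * gen s = u <-> z = u * gen s.
  by split=> [<-|->]; rewrite mul_genK.
have midx : chain_le x (y * gen s) <-> x = z1 \/ x = z2.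
  rewrite -hz; split=> [h|[]//]; split=> //; last by lia.
  exact: chain_le_gen_down.
have other u1 u2 : u1 <> u2 -> x = u1 ->
    (forall z, rank_one_between (x * gen s) (y * gen s) z <->
      z = u1 \/ z = u2) ->
  exists z1 z2, z1 <> z2 /\
    forall z, rank_one_between x y z <-> z = z1 \/ z = z2.
  move=> nu xu hu; exists (y * gen s), (u2 * gen s); split.
    move/(can_inj (mul_genK s)) => yu2.
    have [_ _] : rank_one_between (x * gen s) (y * gen s) y by apply/hu; right.
    by lia.
  have xle : chain_le x (y * gen s).
    by have [] : rank_one_between (x * gen s) (y * gen s) x by apply/hu; left.
  move=> z; rewrite hz' hu -!mulK; split=> [[[zy _]|[[zu|zu] zx]]|[zy|zu]].
  - by left.
  - by case: zx; rewrite zu.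
  - by right.
  - by left.
  - by right; split; [right|rewrite zu xu; apply: nesym].
have [xz1|nxz1] := pselect (x = z1); first exact: (other z1 z2).
have [xz2|nxz2] := pselect (x = z2).
  by apply: (other z2 z1) => // [/esym//|z]; rewrite hz; tauto.
exists (z1 * gen s), (z2 * gen s); split; first by move/(can_inj (mul_genK s)).
move=> z; rewrite hz' hz midx -!mulK.
split=> [[[_ []]//|[]//]|h]; right; split=> // zx.
by case: h; rewrite zx.
Qed.
End CoxeterLength.

(** * Finite graded modular lattices with thin rank two intervals *)

Section ThinModularLattice.

Variables (T : Type) (le : T -> T -> Prop) (rk : T -> nat) (bot : T).
Variables (I : finType) (F : I -> T).

Hypothesis le_modular : modular_lattice le.
Hypothesis F_surj : forall x, exists i, F i = x.
Hypothesis bot_le : forall x, le bot x.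
Hypothesis rk_lt : forall x y, le x y -> x <> y -> rk x < rk y.
Hypothesis rk_between : forall x y, le x y -> (rk x).+1 < rk y ->
  exists z, [/\ le x z, le z y & rk x < rk z < rk y].
Hypothesis thin : forall x y, le x y -> rk y = (rk x).+2 ->
  exists z1 z2, z1 <> z2 /\
    forall z, [/\ le x z, le z y & rk z = (rk x).+1] <-> z = z1 \/ z = z2.

Let le_refl x : le x x.
Proof. by case: le_modular => -[]. Qed.

Let le_trans y x z : le x y -> le y z -> le x z.
Proof. by case: le_modular => -[_ + _] _; apply. Qed.

Lemma rk_le x y : le x y -> rk x <= rk y.
Proof. by move=> xy; have [->//|/(rk_lt xy)/ltnW] := pselect (x = y). Qed.

Lemma rk_eq x y : le x y -> rk y <= rk x -> x = y.
Proof.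
move=> xy yx; have [//|/(rk_lt xy)] := pselect (x = y).
by rewrite ltnNge yx.
Qed.

Lemma exists_cover x y : le x y -> rk x < rk y ->
  exists z, [/\ le x z, le z y & rk z = (rk x).+1].
Proof.
have [n] := ubnP (rk y); elim: n y => // n IHn y ryn xy rxy.
have [rxy'|rxy'] := ltnP (rk x).+1 (rk y); last by exists y; split=> //; lia.
have [z [xz zy /andP[rxz rzy]]] := rk_between xy rxy'.
have [||u [xu uz ru]] := IHn z _ xz; try by lia.
by exists u; split=> //; apply: le_trans uz zy.
Qed.

Lemma exists_cocover x y : le x y -> rk x < rk y ->
  exists z, [/\ le x z, le z y & rk y = (rk z).+1].
Proof.
have [n] := ubnP (rk y - rk x); elim: n x => // n IHn x ryn xy rxy.
have [rxy'|rxy'] := ltnP (rk x).+1 (rk y); last by exists x; split=> //; lia.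
have [z [xz zy /andP[rxz rzy]]] := rk_between xy rxy'.
have [||u [zu uy ru]] := IHn z _ zy; try by lia.
by exists u; split=> //; apply: le_trans xz zu.
Qed.

(** The rank of [bot] need not be zero: for a Bruhat interval it is the length of [v]. *)
Definition atom (a : T) : Prop := rk a = (rk bot).+1.

(** For a cocover [x'] of [x], thinness gives a middle element [z] other than [x] between [x'] and
    [y]. By induction some atom is below [z] and not below [x']; it is not below [x], because [x]
    and [z] meet in [x']. *)
Lemma atom_below_cover x y : le x y -> rk y = (rk x).+1 ->
  exists a, [/\ atom a, le a y & ~ le a x].
Proof.
have [_ [meet [_ [meetP _ _]]]] := le_modular.
have [n] := ubnP (rk x); elim: n x y => // n IHn x y rxn xy rxy.
have [rx|rx] := ltnP (rk bot) (rk x); last first.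
  have ex := rk_eq (bot_le x) rx.
  exists y; rewrite /atom ex; split=> // yx.
  by have := rk_le yx; lia.
have [x' [_ x'x rx']] := exists_cocover (bot_le x) rx.
have [|z1 [z2 [nz hz]]] := thin (le_trans x'x xy); first by lia.
have [z [[x'z zy rz] nzx]] :
    exists z, [/\ le x' z, le z y & rk z = (rk x').+1] /\ z <> x.
  have [<-|nxz1] := pselect (z1 = x).
    by exists z2; split; [apply/hz; right|apply: nesym].
  by exists z1; split=> //; apply/hz; left.
have [||a [ata az nax']] := IHn x' z _ x'z; try by lia.
exists a; split=> //; first exact: le_trans az zy.
have [mx mz mP] := meetP x z => ax.
have x'm := mP _ x'x x'z; have am := mP _ ax az.
have [rm|rm] := leqP (rk x) (rk (meet x z)).
  case: nzx; apply/esym/rk_eq; last by lia.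
  by rewrite -(rk_eq mx rm).
by case: nax'; rewrite (rk_eq x'm) //; lia.
Qed.

Lemma le_atoms x y : (forall a, atom a -> le a x -> le a y) -> le x y.
Proof.
have [_ [meet [_ [meetP _ _]]]] := le_modular.
move=> hxy; have [mx my mP] := meetP x y.
have [<-//|/(rk_lt mx) rm] := pselect (meet x y = x).
have [z [mz zx rz]] := exists_cover mx rm.
have [a [ata az nam]] := atom_below_cover mz rz.
have ax := le_trans az zx.
by case: nam; apply: mP => //; apply: hxy.
Qed.

(** An element [z] strictly between [x] and the join would form a pentagon with [c]: [c] and [z]
    meet in [bot], so the modular law forces [z] below [x]. *)
Lemma rk_join_atom x c : atom c -> ~ le c x ->
  exists y, [/\ le x y, le c y, forall z, le x z -> le c z -> le y z
              & rk y = (rk x).+1].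
Proof.
have [_ [meet [join [meetP joinP modP]]]] := le_modular.
move=> atc ncx; exists (join x c); have [xj cj jP] := joinP x c; split=> //.
have rj : rk x < rk (join x c).
  by apply: rk_lt => // e; case: ncx; rewrite e.
have [rj'|] := ltnP (rk x).+1 (rk (join x c)); last by lia.
have [z [xz zj /andP[rxz rzj]]] := rk_between xj rj'.
have [mc mz mP] := meetP c z; have e := modP x c z xz.
have [rm|rm] := leqP (rk c) (rk (meet c z)).
  have cz : le c z by rewrite -(rk_eq mc rm).
  by have := rk_le (jP _ xz cz); lia.
have mbot : bot = meet c z.
  by apply: (rk_eq (bot_le _)); move: rm; rewrite atc; lia.
have [_ _ /(_ z zj (le_refl z))] := meetP (join x c) z.
rewrite -e -mbot => zx; have [_ _ jbP] := joinP x bot.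
have := rk_le (le_trans zx (jbP x (le_refl x) (bot_le x))); lia.
Qed.

(* For a cocover [x'] of [x], the joins of [x'] with [a] and with [c] are middle
   elements other than [x] of the rank two interval from [x'] to [y], hence
   equal; this lowers [x] to [x']. *)
Lemma atom_le_join x c y a : atom c -> atom a -> ~ le c x -> ~ le a x ->
    le x y -> le c y -> rk y = (rk x).+1 -> le a y -> a = c.
Proof.
have [n] := ubnP (rk x); elim: n x y => // n IHn x y rxn atc ata ncx nax.
move=> xy cy ry ay; have [rx|rx] := ltnP (rk bot) (rk x); last first.
  have ex := rk_eq (bot_le x) rx.
  have top b : atom b -> le b y -> b = y.
    by move=> atb leby; apply: (rk_eq leby); rewrite ry -ex atb.
  by rewrite (top a ata ay) (top c atc cy).
have [x' [_ x'x rx']] := exists_cocover (bot_le x) rx.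
have [|z1 [z2 [nz hz]]] := thin (le_trans x'x xy); first by lia.
have ncx' : ~ le c x' by move=> h; apply: ncx; apply: le_trans h x'x.
have nax' : ~ le a x' by move=> h; apply: nax; apply: le_trans h x'x.
have [yc [x'yc cyc ycP ryc]] := rk_join_atom atc ncx'.
have [ya [x'ya aya yaP rya]] := rk_join_atom ata nax'.
have x'y := le_trans x'x xy.
have /hz zc : [/\ le x' yc, le yc y & rk yc = (rk x').+1].
  by split=> //; apply: ycP.
have /hz za : [/\ le x' ya, le ya y & rk ya = (rk x').+1].
  by split=> //; apply: yaP.
have /hz zx : [/\ le x' x, le x y & rk x = (rk x').+1] by [].
have eya : ya = yc.
  have nxc : x <> yc by move=> e; case: ncx; rewrite e.
  have nxa : x <> ya by move=> e; case: nax; rewrite e.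
  by case: zc za zx nxc nxa => -> [] -> [] ->.
by apply: (IHn x' yc) => //; [lia|rewrite -eya].
Qed.

Theorem thin_modular_boolean : boolean_poset le.
Proof.
(* [{classic T}] supplies the decidable equality needed to turn the listed atoms into a finite
   type. *)
pose atoms : seq {classic T} := [seq F i | i <- enum I & `[< atom (F i) >]].
have mem_atoms a : (a \in atoms) <-> atom a.
  split=> [/mapP[i]|ata]; first by rewrite mem_filter => /andP[/asboolP + _] ->.
  have [i ei] := F_surj a; apply/mapP; exists i => //.
  by rewrite mem_filter mem_enum andbT; apply/asboolP; rewrite ei.
pose A : finType := seq_sub atoms.
have atA (a : A) : atom (val a) by apply/mem_atoms/valP.
pose f (x : T) : {set A} := [set a : A | `[< le (val a) x >]].
have mem_f x a : (a \in f x) <-> le (val a) x.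
  by rewrite inE; split=> [/asboolP|/asboolP].
have f_le x y : le x y <-> f x \subset f y.
  split=> [xy|/subsetP fxy].
    by apply/subsetP => a /mem_f ax; apply/mem_f; apply: le_trans ax xy.
  apply: le_atoms => a /mem_atoms ina ax.
  by apply/(mem_f y (SeqSub ina))/fxy/mem_f.
have f_surj (B : {set A}) : exists x, f x = B.
  suff [x hx] : exists x, forall a : A, le (val a) x <-> a \in enum B.
    by exists x; apply/setP => a; apply/idP/idP=> [/mem_f/hx|ha];
       [rewrite mem_enum|apply/mem_f/hx; rewrite mem_enum].
  (* Joining a new atom [c] adds no other atom, by [atom_le_join]. *)
  elim: (enum B) => [|c s [x hx]].
    by exists bot => a; split=> // /rk_le; rewrite atA ltnn.
  have [cs|ncs] := pselect (le (val c) x).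
    exists x => a; rewrite inE hx.
    split=> [->|/orP[/eqP ->|//]]; first exact: orbT.
    exact/hx.
  have [y [xy cy _ ry]] := rk_join_atom (atA c) ncs.
  exists y => a; rewrite inE; split=> [ay|/orP[/eqP->//|/hx ax]]; last first.
    exact: le_trans ax xy.
  have [/hx ->|nax] := pselect (le (val a) x); first exact: orbT.
  apply/orP; left; apply/eqP/val_inj.
  exact: (atom_le_join (atA c) (atA a) ncs nax xy cy ry ay).
exists A, f; split=> //.
pose g B := sval (cid (f_surj B)).
have fK : cancel g f by move=> B; rewrite /g; case: cid.
exists g => // x; have e := fK (f x).
by apply: rk_eq; [apply/f_le; rewrite e|apply/rk_le/f_le; rewrite e].
Qed.

End ThinModularLattice.

(** * Boolean posets are modular, and the application to Bruhat intervals *)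

Lemma boolean_modular (T : Type) (le : T -> T -> Prop) :
  boolean_poset le -> modular_lattice le.
Proof.
move=> [A [f [[g fK gK] f_le]]]; split.
  split=> [x|x y z|x y].
  - exact/f_le.
  - by rewrite !f_le; apply: subset_trans.
  - rewrite !f_le => xy yx; apply: (can_inj fK).
    by apply/eqP; rewrite eqEsubset xy.
exists (fun x y => g (f x :&: f y)), (fun x y => g (f x :|: f y)); split=> x y.
- split=> [||t]; rewrite !f_le ?gK ?subsetIl ?subsetIr// => tx ty.
  by rewrite subsetI tx.
- split=> [||t]; rewrite !f_le ?gK ?subsetUl ?subsetUr// => tx ty.
  by rewrite subUset tx.
move=> z /f_le xz; rewrite !gK; congr g.
by rewrite setUIr; congr (_ :&: _); apply/setUidPr.
Qed.

Theorem theorem4p2 (G : groupType) (S : eqType) (m : S -> S -> nat)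
    (gen : S -> G) (cox : coxeter_system m gen)
    (v w : G) (le_vw : bruhat gen v w) :
  boolean_poset (@interval_le S G gen v w) <->
  modular_lattice (@interval_le S G gen v w).
Proof.
split; first exact: boolean_modular.
move=> modL; have [[_ _ le_anti] _] := modL.
have leP x y : bruhat gen x y <-> chain_le cox x y := bruhatP cox x y.
have le_refl x : bruhat gen x x by apply/leP/chain_le_refl.
have le_trans x y z : bruhat gen x y -> bruhat gen y z -> bruhat gen x z.
  by move=> /leP xy /leP yz; apply/leP/(chain_le_trans xy yz).
(* Antisymmetry identifies elements that differ only in their membership proofs. *)
have val_inj (x y : bruhat_interval gen v w) : sval x = sval y -> x = y.
  by move=> e; apply: le_anti; rewrite /interval_le e.
pose mk x (vx : bruhat gen v x) (xw : bruhat gen x w) :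
  bruhat_interval gen v w := exist _ x (conj vx xw).
pose bot := mk v (le_refl v) le_vw.
have [b [eb _]] := length_word cox w.
(* By the subword property the masks of one word for [w] reach the whole interval; masks whose
   product falls outside it are sent to [bot]. *)
pose F (t : (size b).-tuple bool) : bruhat_interval gen v w :=
  let x := word_prod gen (mask t b) in
  if pselect (bruhat gen v x /\ bruhat gen x w) is left vxw
  then exist _ x vxw else bot.
apply: (@thin_modular_boolean _ _ (fun x => length cox (sval x)) bot _ F) => //.
- move=> [x vxw]; have [/leP vx /leP xw] := vxw.
  have [a [/subseqP[t szt ->] _ ea]] := chain_le_subword xw eb.
  exists (Tuple (introT eqP szt)); apply: val_inj; rewrite /F /= ea.
  by case: pselect.
- by move=> [x [vx xw]]; rewrite /interval_le.
- move=> x y /leP xy nxy; apply: (chain_le_lt xy) => e.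
  by apply: nxy; apply: val_inj.
- move=> [x [vx xw]] [y [vy yw]] /= /leP xy /(chain_le_between xy).
  move=> [z [/leP xz /leP zy lz]].
  by exists (mk z (le_trans _ _ _ vx xz) (le_trans _ _ _ zy yw)).
move=> [x [vx xw]] [y [vy yw]] /= /leP xy /(chain_le_diamond xy).
move=> [z1 [z2 [nz hz]]].
(* Intervals are convex, so middle elements in the group stay in the interval. *)
have mid z : z = z1 \/ z = z2 -> bruhat gen v z /\ bruhat gen z w.
  move=> /hz[/leP xz /leP zy _].
  by split; [apply: le_trans vx xz|apply: le_trans zy yw].
have [vz1 z1w] := mid z1 (or_introl erefl).
have [vz2 z2w] := mid z2 (or_intror erefl).
exists (mk z1 vz1 z1w), (mk z2 vz2 z2w); split; first by case.
move=> z; have := hz (sval z).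
have -> : (z = mk z1 vz1 z1w) <-> sval z = z1.
  by split=> [->//|e]; apply: val_inj.
have -> : (z = mk z2 vz2 z2w) <-> sval z = z2.
  by split=> [->//|e]; apply: val_inj.
move=> <-; rewrite /interval_le /=.
by split=> -[/leP xz /leP zy lz]; split.
Qed.
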